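(* Suppose $\mathsf{Act}$ is finite. Let $\mathcal C,\mathcal D$ be finite stable configuration structures over $\mathsf{Act}$ and let $s=s(\mathcal C,\mathcal D)$. Then $\mathcal C$ and $\mathcal D$ are hereditary history-preserving (HH) bisimilar if and only if $\mathcal D\models\chi^{s}_{hh}(\mathcal C)$.
   Context: Configuration structures. A configuration structure over $\mathsf{Act}$ is $\mathcal C=(C_{\mathcal C},\ell)$, $C_{\mathcal C}$ a family of finite sets (configurations), $\ell:\bigcup C_{\mathcal C}\to\mathsf{Act}$, events $E_{\mathcal C}$; finite means $C_{\mathcal C}$ finite. Stable: $\emptyset\in C$; every nonempty $X\in C$ has $e\in X$ with $X\setminus\{e\}\in C$; for $X,Y,Z\in C$ with $X\cup Y\subseteq Z$, $X\cup Y\in C$, $X\cap Y\in C$. For $X\in C$: $d\le_Xe$ iff every $Y\in C$ with $Y\subseteq X$, $e\in Y$ contains $d$; $d<_Xe$ iff $d\le_Xe$, $d\ne e$. $X\xrightarrow{e}X'$ iff $X,X'\in C$, $X\subseteq X'$, $X'\setminus X=\{e\}$; $X\xrightarrow{a}X'$ iff this holds with $\ell(e)=a$. $f:X\cong Y$: label-preserving bijection with $d<_Xe\iff f(d)<_Yf(e)$. $s(\mathcal C,\mathcal D)$ is the number of triples $(X,Y,f)$ with $X\in C_{\mathcal C}$, $Y\in C_{\mathcal D}$, $f:X\cong Y$. HH bisimulation: $\mathcal R\subseteq C_{\mathcal C}\times C_{\mathcal D}\times\mathcal P(E_{\mathcal C}\times E_{\mathcal D})$ with $\mathcal R(\emptyset,\emptyset,\emptyset)$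 such that whenever $\mathcal R(X,Y,f)$, $a\in\mathsf{Act}$: $f:X\cong Y$; if $X\xrightarrow{a}X'$ then $\exists Y',f'$: $Y\xrightarrow{a}Y'$, $\mathcal R(X',Y',f')$, $f'\restriction X=f$, and symmetrically; if $X'\xrightarrow{a}X$ then $\exists Y',f'$: $Y'\xrightarrow{a}Y$, $\mathcal R(X',Y',f')$, $f\restriction X'=f'$, and symmetrically. EIL. Syntax $\phi::=\mathrm{tt}\mid\neg\phi\mid\phi\wedge\phi'\mid\langle x:a\rangle\phi\mid(x:a)\phi\mid\langle\!\langle x\rangle\!\rangle\phi$; $\langle x:a\rangle,(x:a)$ bind $x$; $\mathrm{fi}(\langle\!\langle x\rangle\!\rangle\phi)=\mathrm{fi}(\phi)\cup\{x\}$; closed = no free identifiers. Environment $\rho$ permissible for $\phi$ and $X$: $\mathrm{fi}(\phi)\subseteq\mathrm{dom}\rho$, $\rho(\mathrm{fi}(\phi))\subseteq X$. Semantics: $\mathrm{tt},\neg,\wedge$ classical; $X,\rho\models\langle x:a\rangle\phi$ iff $\exists X',e$: $X\xrightarrow{e}X'$, $\ell(e)=a$, $X',\rho[x\mapsto e]\models\phi$; $X,\rho\models(x:a)\phi$ iff $\exists e\in X$, $\ell(e)=a$, $X,\rho[x\mapsto e]\models\phi$; $X,\rho\models\langle\!\langle x\rangle\!\rangle\phi$ iff $\exists X',e$: $X'\xrightarrow{e}X$, $\rho(x)=e$, $\rho$ permissible for $\phi$ and $X'$, $X',\rho\models\phi$. For closed $\phi$, $\mathcal C\models\phi$ iff $\emptyset,\emptyset\models\phi$.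 Abbreviations: $\mathrm{ff}=\neg\mathrm{tt}$, $[x:a]\phi=\neg\langle x:a\rangle\neg\phi$, $\phi\vee\psi=\neg(\neg\phi\wedge\neg\psi)$; empty disjunction is $\mathrm{ff}$, empty conjunction is $\mathrm{tt}$. Formulas $\theta'_X$. Fix distinct identifiers $z_e$ for $e\in E_{\mathcal C}$ and a further identifier $x$ distinct from all of them. For a configuration $X$ of $\mathcal C$ with $|X|=n$, enumerate $X=\{e_1,\dots,e_n\}$ so that $e_i<_Xe_j$ implies $i<j$, write $z_i=z_{e_i}$. Let $\theta^0_X=\langle\!\langle z_n\rangle\!\rangle\cdots\langle\!\langle z_1\rangle\!\rangle\mathrm{tt}$, and for $k=1,\dots,n$ let $i_1>\dots>i_{r_k}$ list $\{j<k:\text{not } e_j<_Xe_k\}$ and $\theta^k_X=\langle\!\langle z_n\rangle\!\rangle\cdots\langle\!\langle z_{k+1}\rangle\!\rangle\langle\!\langle z_{i_1}\rangle\!\rangle\cdots\langle\!\langle z_{i_{r_k}}\rangle\!\rangle\bigwedge_{j:\,e_j<_Xe_k}\neg\langle\!\langle z_j\rangle\!\rangle\mathrm{tt}$. Then $\theta'_X=\bigwedge_{k=0}^n\theta^k_X$ (so $\theta'_\emptyset=\mathrm{tt}$), with free identifiers $\{z_e:e\in X\}$. Characteristic formulas. For configurations $X$ of $\mathcal C$ define by induction on $n$: $\chi^0_{hh}(X)=\theta'_X$ and $\chi^{n+1}_{hh}(X)=\theta'_X\wedge\bigwedge_{X\xrightarrow{e}X'}\langle z_e:\ell(e)\rangle\chi^n_{hh}(X')\wedge\bigwedge_{a\in\mathsf{Act}}[x:a]\bigvee_{X\xrightarrow{e}X',\,\ell(e)=a}\chi^n_{hh}(X')[x/z_e]\wedge\bigwedge_{X'\xrightarrow{e}X}\langle\!\langle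 z_e\rangle\!\rangle\chi^n_{hh}(X')$, where $[x/z_e]$ replaces free occurrences of $z_e$ by $x$. Let $\chi^n_{hh}(\mathcal C)=\chi^n_{hh}(\emptyset)$ (a closed formula). *)

(* Defs.v *)
From HB Require Import structures.
From mathcomp Require Import all_boot finmap.

Set Implicit Arguments.
Unset Strict Implicit.
Unset Printing Implicit Defensive.

Local Open Scope fset_scope.

(* A finite configuration structure: finitely many configurations, each a     *)
(* finite set.  Events live in an arbitrary universe [E]; the events of the   *)
(* structure are those of [events], and the values of [lab] elsewhere are     *)
(* never used.                                                                *)
Record conf_struct (Act : finType) (E : choiceType) := ConfStruct {
  confs : {fset {fset E}};
  lab : E -> Act
}.

Section ConfigurationStructures.
Variables (Act : finType) (E : choiceType) (C : conf_struct Act E).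
Implicit Types (X Y Z : {fset E}) (d e : E) (a : Act).

Definition events : {fset E} := \bigcup_(X <- confs C) X.

Definition stable : Prop :=
  [/\ fset0 \in confs C,
      forall X, X \in confs C -> X != fset0 ->
        exists2 e, e \in X & X `\ e \in confs C
    & forall X Y Z, X \in confs C -> Y \in confs C -> Z \in confs C ->
        X `|` Y `<=` Z -> X `|` Y \in confs C /\ X `&` Y \in confs C].

(* Causality [d <=_X e] and [d <_X e], meant for [X] a configuration and      *)
(* [d], [e] in [X].                                                           *)
Definition cause X d e : bool :=
  [forall Y : confs C, (val Y `<=` X) && (e \in val Y) ==> (d \in val Y)].

Definition scause X d e : bool := cause X d e && (d != e).

Definition step X e X' : bool :=
  [&& X \in confs C, X' \in confs C, X `<=` X' & X' `\` X == [fset e]].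

Definition lstep X a X' : Prop := exists2 e, step X e X' & lab C e = a.

End ConfigurationStructures.

Section Bisimulation.
Variables (Act : finType) (E F : choiceType).
Variables (C : conf_struct Act E) (D : conf_struct Act F).
Implicit Types (X : {fset E}) (Y : {fset F}) (f : {fset E * F}).

(* [f : X ~= Y], with [f] given by its graph: the first three conjuncts say   *)
(* that [f] is the graph of a bijection from [X] onto [Y].                    *)
Definition conf_iso X Y f : bool :=
  [&& [fset p.1 | p in f] == X,
      [fset p.2 | p in f] == Y,
      [forall p : f, forall q : f,
        ((val p).1 == (val q).1) == ((val p).2 == (val q).2)],
      [forall p : f, lab C (val p).1 == lab D (val p).2]
    & [forall p : f, forall q : f,
        scause C X (val p).1 (val q).1 == scause D Y (val p).2 (val q).2]].

Definition num_isos : nat :=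
  #|` [fset t in (confs C `*` confs D) `*` fpowerset (events C `*` events D)
        | conf_iso t.1.1 t.1.2 t.2] |.

Definition frestr f X : {fset E * F} := [fset p in f | p.1 \in X].

(* Since [R X Y f] forces [f] to be an isomorphism of finite sets, taking [f] *)
(* among the finite subsets of [E * F] is no restriction.                     *)
Definition hh_bisimulation
    (R : {fset E} -> {fset F} -> {fset E * F} -> Prop) : Prop :=
  R fset0 fset0 fset0 /\
  forall X Y f, R X Y f ->
    [/\ X \in confs C, Y \in confs D & conf_iso X Y f] /\
    forall a : Act,
    [/\ forall X', lstep C X a X' -> exists Y' f',
          [/\ lstep D Y a Y', R X' Y' f' & frestr f' X = f],
        forall Y', lstep D Y a Y' -> exists X' f',
          [/\ lstep C X a X', R X' Y' f' & frestr f' X = f],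
        forall X', lstep C X' a X -> exists Y' f',
          [/\ lstep D Y' a Y, R X' Y' f' & frestr f X' = f']
      & forall Y', lstep D Y' a Y -> exists X' f',
          [/\ lstep C X' a X, R X' Y' f' & frestr f X' = f']].

Definition hh_bisimilar : Prop := exists R, hh_bisimulation R.

End Bisimulation.

Inductive eil (Act : Type) (Id : Type) : Type :=
| Tt
| Neg of eil Act Id
| And of eil Act Id & eil Act Id
| Dia of Id & Act & eil Act Id      (* <x : a> phi  *)
| Bind of Id & Act & eil Act Id     (* (x : a) phi  *)
| Rev of Id & eil Act Id.           (* <<x>> phi    *)

Arguments Tt {Act Id}.
Arguments Rev {Act Id} _ _.

Section Logic.
Variables (Act : finType) (Id : choiceType).
Implicit Types (phi psi : eil Act Id) (x y w : Id) (a : Act).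

Fixpoint fi phi : {fset Id} :=
  match phi with
  | Tt => fset0
  | Neg phi => fi phi
  | And phi psi => fi phi `|` fi psi
  | Dia x _ phi | Bind x _ phi => fi phi `\ x
  | Rev x phi => x |` fi phi
  end.

Definition Ff : eil Act Id := Neg Tt.
Definition Or phi psi := Neg (And (Neg phi) (Neg psi)).
Definition Box x a phi := Neg (Dia x a (Neg phi)).

Fixpoint bigAnd (s : seq (eil Act Id)) : eil Act Id :=
  match s with
  | [::] => Tt
  | [:: phi] => phi
  | phi :: s' => And phi (bigAnd s')
  end.

Fixpoint bigOr (s : seq (eil Act Id)) : eil Act Id :=
  match s with
  | [::] => Ff
  | [:: phi] => phi
  | phi :: s' => Or phi (bigOr s')
  end.

Section Semantics.
Variables (E : choiceType) (C : conf_struct Act E).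

(* Environments are partial functions. *)
Definition env := Id -> option E.

Definition upd (rho : env) x e : env := [eta rho with x |-> Some e].

Definition permissible (rho : env) phi (X : {fset E}) : Prop :=
  forall x, x \in fi phi -> exists2 e, rho x = Some e & e \in X.

Fixpoint sat (X : {fset E}) (rho : env) phi : Prop :=
  match phi with
  | Tt => True
  | Neg phi => ~ sat X rho phi
  | And phi psi => sat X rho phi /\ sat X rho psi
  | Dia x a phi => exists X' e,
      [/\ step C X e X', lab C e = a & sat X' (upd rho x e) phi]
  | Bind x a phi => exists e,
      [/\ e \in X, lab C e = a & sat X (upd rho x e) phi]
  | Rev x phi => exists X' e,
      [/\ step C X' e X, rho x = Some e, permissible rho phi X'
        & sat X' rho phi]
  end.

Definition models phi : Prop := sat fset0 (fun=> None) phi.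

End Semantics.

Hypothesis Id_inf : forall A : {fset Id}, exists y, y \notin A.

(* Capture-avoiding renaming of the free identifiers of a formula along       *)
(* [sigma]: a binder is changed, to a fresh identifier, exactly when it would *)
(* capture.  Avoiding capture is essential below, where the identifier        *)
(* substituted is itself bound inside the formula.                            *)
Fixpoint rename (sigma : Id -> Id) phi : eil Act Id :=
  let avoid w psi :=
    let A := [fset sigma v | v in fi psi `\ w] in
    if w \in A then xchoose (Id_inf A) else w in
  match phi with
  | Tt => Tt
  | Neg phi => Neg (rename sigma phi)
  | And phi psi => And (rename sigma phi) (rename sigma psi)
  | Dia w a phi =>
      let w' := avoid w phi in
      Dia w' a (rename [eta sigma with w |-> w'] phi)
  | Bind w a phi =>
      let w' := avoid w phi in
      Bind w' a (rename [eta sigma with w |-> w'] phi)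
  | Rev w phi => Rev (sigma w) (rename sigma phi)
  end.

(* [phi[x/y]] *)
Definition subst x y phi : eil Act Id := rename [eta id with y |-> x] phi.

Section Characteristic.
Variables (E : choiceType) (C : conf_struct Act E).
Variables (z : E -> Id) (x : Id) (en : {fset E} -> seq E).
Implicit Types (X : {fset E}) (e : E).

(* [en X] is the enumeration e_1, ..., e_n of [X]; here [e] = e_k is given by *)
(* its position in [en X].                                                    *)
Definition theta0 X : eil Act Id := foldr Rev Tt (map z (rev (en X))).

Definition theta_at X e : eil Act Id :=
  let s := en X in
  let k := index e s in
  foldr Rev
    (bigAnd [seq Neg (Rev (z d) Tt) | d <- s & scause C X d e])
    (map z (rev (drop k.+1 s) ++
            rev [seq d <- take k s | ~~ scause C X d e])).

Definition theta X : eil Act Id :=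
  bigAnd (theta0 X :: [seq theta_at X e | e <- en X]).

Definition fwd X : {fset E * {fset E}} :=
  [fset p in events C `*` confs C | step C X p.1 p.2].

Definition bwd X : {fset E * {fset E}} :=
  [fset p in events C `*` confs C | step C p.2 p.1 X].

Fixpoint chi (n : nat) X : eil Act Id :=
  if n is m.+1 then
    And (And (And (theta X)
      (bigAnd [seq Dia (z p.1) (lab C p.1) (chi m p.2) | p <- fwd X]))
      (bigAnd [seq Box x a
                 (bigOr [seq subst x (z p.1) (chi m p.2)
                        | p <- fwd X & lab C p.1 == a])
              | a <- enum Act]))
      (bigAnd [seq Rev (z p.1) (chi m p.2) | p <- bwd X])
  else theta X.

Definition chi_hh (n : nat) : eil Act Id := chi n fset0.

End Characteristic.

End Logic.

(* Every [en X] lists [X] without repetition, causes before effects. *)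
Definition causal_enumeration (Act : finType) (E : choiceType)
    (C : conf_struct Act E) (en : {fset E} -> seq E) : Prop :=
  forall X, X \in confs C ->
    [/\ uniq (en X), en X =i X
      & forall d e, d \in X -> e \in X -> scause C X d e ->
          index d (en X) < index e (en X)].

(* Main.v *)
(* With [rho] sending [z_e] to [f e], where [f] is a label-preserving map on   *)
(* [X] and [#|X| = #|Y|], the formula [theta X] holds at [Y] exactly when [f]  *)
(* is an isomorphism [X ~= Y]: [theta0] makes [f] a bijection, the removals    *)
(* in [theta_at X e] make the image of [{d | d <=_X e}] a configuration, so    *)
(* nothing else lies below [f e], and its negative part says that nothing but  *)
(* [f e] is removable from that image, so everything in it lies below [f e].   *)
(* Hence [chi n X] expresses the n-th approximant of HH bisimilarity.  The     *)
(* approximants form a decreasing chain of subsets of the [s] isomorphisms in  *)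
(* which one equality propagates forever, so the chain is stationary from      *)
(* index [s] on, and its limit is an HH bisimulation.                          *)

Require Import Defs.
From HB Require Import structures.
From mathcomp Require Import all_boot finmap.
From mathcomp Require Import boolp.

Set Implicit Arguments.
Unset Strict Implicit.
Unset Printing Implicit Defensive.

Local Open Scope fset_scope.

(** A formula [chi n X] is evaluated at [Y] in an environment encoding a map [f] from [X] to [Y]:
    [z e] is sent to the partner of [e]. The invariant [compat] records this, and forward and
    backward steps preserve it.

    For [theta] ([sat_theta]), one direction rests on transport: an isomorphism carries causally
    closed subsets of [X] to configurations of [Y] ([iso_img_conf]), so the prescribed removals can
    be carried out. The other direction rests on [removable_outside]: if the image of the events
    below [e] were larger than the set of events below the partner of [e], some other event could be
    removed from it, against the negative part of [theta_at].

    By induction on [n], the three families of conjuncts of [chi] become the three clauses of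
    [approx] ([sat_chi]). Backward moves of [D] have no conjunct; [step_pred_iso] supplies the
    matching move of [C].

    Every bisimulation is contained in all approximants ([hh_bisimulation_approx]), and an
    approximant contained in its successor is a bisimulation ([approx_hh_bisimulation]). A count of
    isomorphisms shows that index [num_isos] is large enough for that ([approx_stable]). *)

(** * Causality and configurations in stable structures *)

Section StableStructures.
Variables (Act : finType) (E : choiceType) (C : conf_struct Act E).
Implicit Types (X Y Z V W : {fset E}) (d e : E).

Lemma stepP X e X' :
  reflect [/\ X \in confs C, X' \in confs C, e \notin X & X' = e |` X]
          (step C X e X').
Proof.
apply: (iffP and4P) => [[XC X'C sXX' /eqP X'X]|[XC X'C eX eqX']].
  have /fsetDP[_ eX] : e \in X' `\` X by rewrite X'X in_fset1.
  by split=> //; rewrite -[LHS](fsetID X) (fsetIidPr sXX') X'X fsetUC.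
split=> //; first by rewrite eqX' fsubsetU1.
apply/eqP/fsetP=> d; rewrite eqX' !inE.
by have [->|] := eqVneq d e; rewrite ?eX //= andNb.
Qed.

Lemma step_fsetD1 X e : X \in confs C -> X `\ e \in confs C -> e \in X ->
  step C (X `\ e) e X.
Proof. by move=> XC XeC eX; apply/stepP; split; rewrite ?fsetD1K // !inE eqxx. Qed.

Lemma step_pred X e X' : step C X e X' -> e \in X' /\ X = X' `\ e.
Proof. by case/stepP=> _ _ eX ->; rewrite fsetU1K // !inE eqxx. Qed.

Lemma sub_events X : X \in confs C -> X `<=` events C.
Proof. by move=> XC; apply/fsubsetP=> e eX; apply/bigfcupP; exists X; rewrite ?XC. Qed.

Lemma causeP X d e :
  reflect (forall Y, Y \in confs C -> Y `<=` X -> e \in Y -> d \in Y)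
          (cause C X d e).
Proof.
apply: (iffP forallP) => [h Y YC sYX eY|h Y].
  by have := h [` YC]; rewrite sYX eY.
by apply/implyP=> /andP[]; apply: h; apply: valP.
Qed.

Lemma cause_refl X e : cause C X e e.
Proof. exact/causeP. Qed.

Hypothesis stC : stable C.

Lemma fset0_conf : fset0 \in confs C.
Proof. by case: stC. Qed.

Lemma confU X Y Z : X \in confs C -> Y \in confs C -> Z \in confs C ->
  X `<=` Z -> Y `<=` Z -> X `|` Y \in confs C.
Proof.
by case: stC => _ _ h XC YC ZC sX sY; have [] := h X Y Z XC YC ZC; rewrite // fsubUset sX.
Qed.

Lemma confI X Y Z : X \in confs C -> Y \in confs C -> Z \in confs C ->
  X `<=` Z -> Y `<=` Z -> X `&` Y \in confs C.
Proof.
by case: stC => _ _ h XC YC ZC sX sY; have [] := h X Y Z XC YC ZC; rewrite // fsubUset sX.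
Qed.

(** A configuration [Z] inside [X] that contains [e] can be cut down to its intersection with [Y],
    which is again a configuration by stability. *)
Lemma cause_sub X Y d e : X \in confs C -> Y \in confs C -> Y `<=` X ->
  e \in Y -> cause C Y d e = cause C X d e.
Proof.
move=> XC YC sYX eY; apply/causeP/causeP=> h Z ZC sZ eZ.
  have := h (Z `&` Y) (confI ZC YC XC sZ sYX) (fsubsetIr _ _).
  by rewrite !inE eZ eY => /(_ isT)/andP[].
by apply: h => //; apply: fsubset_trans sYX.
Qed.

Definition down X e : {fset E} := [fset d in X | cause C X d e].

Lemma in_down X d e : (d \in down X e) = (d \in X) && cause C X d e.
Proof. by rewrite !inE. Qed.

Lemma mem_down X d e : d \in X -> (d \in down X e) = (d == e) || scause C X d e.
Proof.
by rewrite in_down /scause => -> /=; case: eqVneq => [->|]; rewrite ?cause_refl ?andbT.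
Qed.

(** The events below [e] are the intersection of the finitely many configurations inside [X] that
    contain [e]; all are bounded by [X], so stability applies. *)
Lemma down_conf X e : X \in confs C -> e \in X -> down X e \in confs C.
Proof.
move=> XC eX.
(* Membership of [Z] in [confs C] appears twice so that the induction runs over the enumeration
   alone. *)
have [Y [YC sYX eY minY]] : exists Y, [/\ Y \in confs C, Y `<=` X, e \in Y &
    forall Z, Z \in enum_fset (confs C) -> Z \in confs C -> Z `<=` X -> e \in Z -> Y `<=` Z].
  elim: (enum_fset _) => [|Z s [Y [YC sYX eY minY]]]; first by exists X.
  have [/and3P[ZC sZX eZ]|nZ] := boolP [&& Z \in confs C, Z `<=` X & e \in Z].
    exists (Y `&` Z); split=> [||| V]; first exact: confI XC _ _.
    - exact: fsubset_trans (fsubsetIl _ _) _.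
    - by rewrite inE eY.
    - rewrite inE => /predU1P[-> *|Vs VC sV eV]; first exact: fsubsetIr.
      exact: fsubset_trans (fsubsetIl _ _) (minY V Vs VC sV eV).
  exists Y; split=> // V; rewrite inE => /predU1P[-> ZC sZX eZ|]; last exact: minY.
  by rewrite ZC sZX eZ in nZ.
suff -> : down X e = Y by [].
apply/fsetP=> d; rewrite !inE /=; apply/andP/idP=> [[_ /causeP h]|dY]; first exact: h.
split; first exact: (fsubsetP sYX).
by apply/causeP=> Z ZC sZ eZ; apply: (fsubsetP (minY Z ZC ZC sZ eZ)).
Qed.

(** [Z] is the union of the sets [down X e] for [e] in [Z], and a finite union of configurations
    bounded by [X] is a configuration. *)
Lemma down_closed_conf X Z : X \in confs C -> Z `<=` X ->
  (forall d e, d \in X -> e \in Z -> scause C X d e -> d \in Z) -> Z \in confs C.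
Proof.
move=> XC sZX dcZ.
have dZ e : e \in Z -> down X e `<=` Z.
  move=> eZ; apply/fsubsetP=> d dd; have : d \in X by move: dd; rewrite !inE => /andP[].
  by move=> dX; move: dd; rewrite mem_down // => /predU1P[->|/(dcZ d e dX eZ)].
have dX e : e \in Z -> down X e `<=` X by move=> eZ; apply: fsubset_trans (dZ _ eZ) sZX.
have h (s : seq E) : {subset s <= Z} ->
    \bigcup_(e <- s) down X e \in confs C /\ \bigcup_(e <- s) down X e `<=` X.
  elim: s => [|e s IH] sZ; first by rewrite big_nil fset0_conf fsub0set.
  have eZ : e \in Z by apply: sZ; rewrite inE eqxx.
  have [|UC sU] := IH; first by move=> d ds; apply: sZ; rewrite inE ds orbT.
  rewrite big_cons fsubUset dX // sU; split=> //.
  apply: (confU _ UC XC (dX e eZ) sU); apply: down_conf => //.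
  exact: (fsubsetP sZX).
suff <- : \bigcup_(e <- Z) down X e = Z by have [] := h Z.
apply/fsetP=> d; apply/bigfcupP/idP => [[e /andP[eZ _]]|dZ'].
  exact: (fsubsetP (dZ _ eZ)).
by exists d; rewrite ?dZ' // mem_down ?eqxx // (fsubsetP sZX).
Qed.

Lemma conf_down_closed X Z d e : Z \in confs C -> Z `<=` X -> e \in Z ->
  scause C X d e -> d \in Z.
Proof. by move=> ZC sZX eZ /andP[/causeP h _]; apply: h. Qed.

(* If the event removable from [W] lies in [V], remove it from both, recurse, *)
(* and put it back by taking the union with [V].                              *)
Lemma removable_outside V W : V \in confs C -> W \in confs C -> V `<` W ->
  exists2 c, c \in W `\` V & W `\ c \in confs C.
Proof.
move: {2}#|`W| (erefl #|`W|) => n; elim: n V W => [|n IH] V W.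
  by move=> /eqP; rewrite cardfs_eq0 => /eqP-> _ _; rewrite fproperE fsub0set andbF.
move=> cW VC WC pVW; have sVW := fproper_sub pVW.
have [c cW' WcC] : exists2 e, e \in W & W `\ e \in confs C.
  by case: stC => _ h _; apply: h => //; rewrite -cardfs_gt0 cW.
have [cV|cV] := boolP (c \in V); last by exists c; rewrite // !inE cV.
have sWc : W `\ c `<=` W by apply: fsubD1set.
have eVc : V `&` (W `\ c) = V `\ c.
  apply/fsetP=> d; rewrite !inE andbCA; case: (boolP (d \in V)) => [/(fsubsetP sVW)->|].
    by rewrite !andbT.
  by rewrite !andbF.
have VcC : V `\ c \in confs C by rewrite -eVc; apply: confI WC _ _.
have [|| c2 c2W W2C] := IH (V `\ c) (W `\ c) _ VcC WcC.
- by move: cW; rewrite (cardfsD1 c W) cW' => -[].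
- rewrite -eVc; rewrite fproperE fsubsetIr /=; apply: contraL (pVW) => h.
  rewrite fproperE negb_and negbK; apply/orP; right; apply/fsubsetP=> d dW.
  have [->//|dc] := eqVneq d c.
  have /(fsubsetP h) : d \in W `\ c by rewrite !inE dc.
  by rewrite inE => /andP[].
move: c2W; rewrite !inE => /andP[+ /andP[c2c c2W]]; rewrite c2c /= => c2V.
exists c2; first by rewrite !inE c2V.
suff -> : W `\ c2 = ((W `\ c) `\ c2) `|` V.
  by apply: confU WC _ _ => //; apply: fsubset_trans (fsubD1set _ _) _.
apply/fsetP=> d; rewrite !inE; have [->|dc] := eqVneq d c.
  by rewrite cV orbT cW' andbT eq_sym.
have [->|dc2] /= := eqVneq d c2; first by rewrite (negPf c2V).
by case: (boolP (d \in V)) => [/(fsubsetP sVW)->|]; rewrite ?orbF.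
Qed.

End StableStructures.

(** * Satisfaction, free identifiers and renaming *)

Section SatBig.
Variables (Act : finType) (Id E : choiceType) (C : conf_struct Act E).
Implicit Types (X : {fset E}) (rho : env Id E) (phi : eil Act Id).

Lemma sat_Or X rho phi psi :
  sat C X rho (Or phi psi) <-> sat C X rho phi \/ sat C X rho psi.
Proof.
split=> /= [h|[h [n _]|h [_ n]]] //; apply: contrapT => n; apply: h.
by split=> h; apply: n; [left|right].
Qed.

Lemma sat_Box X rho y a phi :
  sat C X rho (Box y a phi) <->
  forall X' e, step C X e X' -> lab C e = a -> sat C X' (upd rho y e) phi.
Proof.
split=> /= [h X' e st la|h [X' [e [st la]]]]; last by apply; apply: h.
by apply: contrapT => n; apply: h; exists X', e.
Qed.

Lemma sat_bigAnd_cons X rho phi s :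
  sat C X rho (bigAnd (phi :: s)) <-> sat C X rho phi /\ sat C X rho (bigAnd s).
Proof. by case: s => [|psi s] //=; split=> // -[]. Qed.

Lemma sat_bigAnd (I : eqType) (g : I -> eil Act Id) X rho (s : seq I) :
  sat C X rho (bigAnd [seq g i | i <- s]) <-> {in s, forall i, sat C X rho (g i)}.
Proof.
elim: s => [|i s IH] //; rewrite map_cons sat_bigAnd_cons IH.
split=> [[gi gs] j|h]; first by rewrite inE => /predU1P[->|/gs].
by split=> [|j js]; apply: h; rewrite inE ?eqxx ?js ?orbT.
Qed.

Lemma sat_bigOr (I : eqType) (g : I -> eil Act Id) X rho (s : seq I) :
  sat C X rho (bigOr [seq g i | i <- s]) <-> exists2 i, i \in s & sat C X rho (g i).
Proof.
have cons phi s' : sat C X rho (bigOr (phi :: s')) <->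
    sat C X rho phi \/ sat C X rho (bigOr s').
  case: s' => [|psi s']; last exact: sat_Or.
  by split=> [|[]] //; [left|move=> /= h; case: (h Logic.I)].
elim: s => [|i s IH]; first by split=> [/= h|[]] //; case: (h Logic.I).
rewrite map_cons cons IH; split=> [[gi|[j js gj]]|[j]].
- by exists i; rewrite ?inE ?eqxx.
- by exists j; rewrite ?inE ?js ?orbT.
- by rewrite inE => /predU1P[->|js gj]; [left|right; exists j].
Qed.

Lemma fi_bigAnd (I : eqType) (g : I -> eil Act Id) (s : seq I) y :
  y \in fi (bigAnd [seq g i | i <- s]) -> exists2 i, i \in s & y \in fi (g i).
Proof.
elim: s => [|i s IH] // h.
have : y \in fi (g i) `|` fi (bigAnd [seq g i | i <- s]).
  by case: (s) h => [|j s'] //= h; rewrite fsetU0.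
rewrite inE => /orP[yi|/IH[j js yj]]; first by exists i; rewrite ?inE ?eqxx.
by exists j; rewrite ?inE ?js ?orbT.
Qed.

Lemma fi_bigOr (I : eqType) (g : I -> eil Act Id) (s : seq I) y :
  y \in fi (bigOr [seq g i | i <- s]) -> exists2 i, i \in s & y \in fi (g i).
Proof.
elim: s => [|i s IH] // h.
have : y \in fi (g i) `|` fi (bigOr [seq g i | i <- s]).
  by case: (s) h => [|j s'] //= h; rewrite fsetU0.
rewrite inE => /orP[yi|/IH[j js yj]]; first by exists i; rewrite ?inE ?eqxx.
by exists j; rewrite ?inE ?js ?orbT.
Qed.

Lemma fi_foldr_Rev (l : seq Id) phi y :
  y \in fi (foldr Rev phi l) = (y \in l) || (y \in fi phi).
Proof. by elim: l => //= w l IH; rewrite !inE IH orbA. Qed.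

Lemma sat_ext phi X rho rho' : {in fi phi, rho =1 rho'} ->
  sat C X rho phi <-> sat C X rho' phi.
Proof.
elim: phi X rho rho' => [|phi IH|phi IH psi IH'|w a phi IH|w a phi IH|w phi IH]
  X rho rho' eqr //=.
- by rewrite (IH X rho rho').
- rewrite (IH X rho rho'); last by move=> y yp; apply: eqr; rewrite inE yp.
  by rewrite (IH' X rho rho') // => y yp; apply: eqr; rewrite inE yp orbT.
- have eqw e : {in fi phi, upd rho w e =1 upd rho' w e}.
    by move=> y yp; rewrite /upd /=; case: (eqVneq y w) => // yw; apply: eqr; rewrite !inE yw.
  by split=> -[X' [e [st la h]]]; exists X', e; split=> //; apply/(IH X' _ _ (eqw e)).
- have eqw e : {in fi phi, upd rho w e =1 upd rho' w e}.
    by move=> y yp; rewrite /upd /=; case: (eqVneq y w) => // yw; apply: eqr; rewrite !inE yw.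
  by split=> -[e [st la h]]; exists e; split=> //; apply/(IH X _ _ (eqw e)).
- have eqp : {in fi phi, rho =1 rho'} by move=> y yp; apply: eqr; rewrite !inE yp orbT.
  have eqw : rho w = rho' w by apply: eqr; rewrite !inE eqxx.
  rewrite /permissible eqw.
  by split=> -[X' [e [st re pm h]]]; exists X', e; split=> //;
    first [by move=> y yp; have := pm y yp; rewrite eqp
          |by apply/(IH X' _ _ eqp)].
Qed.

Section Renaming.
Hypothesis Id_inf : forall A : {fset Id}, exists y, y \notin A.
Implicit Type sigma : Id -> Id.

(** A copy of the local definition inside [rename], convertible with it, so that facts about the
    chosen binder can be stated. *)
Let avoid sigma w phi : Id :=
  let A := [fset sigma v | v in fi phi `\ w] in
  if w \in A then xchoose (Id_inf A) else w.

Let avoidP sigma w phi v :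
  v \in fi phi -> v != w -> sigma v != avoid sigma w phi.
Proof.
move=> vp vw; rewrite /avoid; set A := [fset _ | _ in _].
have vA : sigma v \in A by apply/imfsetP; exists v => //=; rewrite !inE vw.
apply: contraTneq vA => ->; case: ifP => [_|->] //.
exact: (xchooseP (Id_inf A)).
Qed.

Let fi_avoid sigma w phi y :
  reflect (exists2 v, v \in fi phi `\ w & y = sigma v)
    ((y != avoid sigma w phi) &&
     (y \in [fset [eta sigma with w |-> avoid sigma w phi] v | v in fi phi])).
Proof.
apply: (iffP andP) => [[yw /imfsetP[v /= vp yv]]|[v]].
  by move: yv yw; case: (eqVneq v w) => [_ ->|vw ->]; rewrite ?eqxx // => _; exists v;
    rewrite // !inE vw.
rewrite !inE => /andP[vw vp] ->; split; first exact: avoidP.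
by apply/imfsetP; exists v; rewrite //= (negPf vw).
Qed.

(** Needed for [sat_rename]: the clause for [Rev] tests permissibility, which depends on the free
    identifiers of the renamed formula. *)
Lemma fi_rename sigma phi :
  fi (rename Id_inf sigma phi) = [fset sigma v | v in fi phi].
Proof.
have bind w psi sigma' : fi (rename Id_inf [eta sigma' with w |-> avoid sigma' w psi] psi)
    = [fset [eta sigma' with w |-> avoid sigma' w psi] v | v in fi psi] ->
    fi (rename Id_inf [eta sigma' with w |-> avoid sigma' w psi] psi)
      `\ avoid sigma' w psi = [fset sigma' v | v in fi psi `\ w].
  move=> ->; apply/fsetP=> y; rewrite in_fsetD1.
  by apply/fi_avoid/imfsetP=> -[v vp ->]; exists v.
elim: phi sigma => [|phi IH|phi IH psi IH'|w a phi IH|w a phi IH|w phi IH] sigma /=.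
- by apply/fsetP=> y; rewrite !inE; apply/esym/imfsetP=> -[].
- exact: IH.
- by rewrite IH IH' imfsetU.
- exact: bind.
- exact: bind.
- by rewrite IH imfsetU imfset_fset1.
Qed.

(** At a binder, freshness of the new identifier makes its update agree, on the free identifiers of
    the body, with the update of the old one before renaming. *)
Lemma sat_rename sigma phi X rho :
  sat C X rho (rename Id_inf sigma phi) <-> sat C X (rho \o sigma) phi.
Proof.
have bind w psi sigma' rho' e :
    {in fi psi, upd rho' (avoid sigma' w psi) e \o
                  [eta sigma' with w |-> avoid sigma' w psi]
                =1 upd (rho' \o sigma') w e}.
  move=> v vp; rewrite /upd /=; case: (eqVneq v w) => [_|vw] /=; first by rewrite eqxx.
  by rewrite (negPf (avoidP _ vp vw)).
elim: phi sigma X rho => [|phi IH|phi IH psi IH'|w a phi IH|w a phi IH|w phi IH]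
  sigma X rho //=.
- by rewrite IH.
- by rewrite IH IH'.
- by split=> -[X' [e [st la h]]]; exists X', e; split=> //; move: h;
    rewrite IH (sat_ext _ (@bind w phi sigma rho e)).
- by split=> -[e [st la h]]; exists e; split=> //; move: h;
    rewrite IH (sat_ext _ (@bind w phi sigma rho e)).
- split=> -[X' [e [st re pm /IH h]]]; exists X', e; split=> //.
    by move=> v vp; apply: pm; rewrite fi_rename; apply/imfsetP; exists v.
  by move=> y; rewrite fi_rename => /imfsetP[v vp ->]; apply: pm.
Qed.

End Renaming.
End SatBig.

Lemma pairwise_rev (T : Type) (r : rel T) (s : seq T) :
  pairwise r (rev s) = pairwise (fun x y => r y x) s.
Proof.
by elim: s => //= a s IH; rewrite rev_cons -cats1 pairwise_cat IH allrel1r all_rev /= andbT.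
Qed.

(** * Graphs of bijections and images of configurations *)

Section Isomorphisms.
Variables (Act : finType) (E F : choiceType).
Variables (C : conf_struct Act E) (D : conf_struct Act F).
Implicit Types (X Z : {fset E}) (Y : {fset F}) (f : {fset E * F}).

Definition bij_graph X Y f : Prop :=
  [/\ [fset p.1 | p in f] = X, [fset p.2 | p in f] = Y
    & {in f &, forall p q, (p.1 == q.1) = (p.2 == q.2)}].

Lemma conf_isoP X Y f :
  reflect [/\ bij_graph X Y f, {in f, forall p, lab C p.1 = lab D p.2}
    & {in f &, forall p q, scause C X p.1 q.1 = scause D Y p.2 q.2}]
    (conf_iso C D X Y f).
Proof.
apply: (iffP and5P) => [[/eqP eX /eqP eY /forallP b /forallP l /forallP o]|].
  split; first split=> //.
  - by move=> p q pf qf; exact: (eqP (forallP (b (FSetSub pf)) (FSetSub qf))).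
  - by move=> p pf; apply/eqP; apply: (l (FSetSub pf)).
  - by move=> p q pf qf; exact: (eqP (forallP (o (FSetSub pf)) (FSetSub qf))).
move=> [[-> -> b] l o]; split=> //.
- by apply/forallP=> p; apply/forallP=> q; rewrite (b _ _ (fsvalP p) (fsvalP q)).
- by apply/forallP=> p; rewrite (l _ (fsvalP p)).
- by apply/forallP=> p; apply/forallP=> q; rewrite (o _ _ (fsvalP p) (fsvalP q)).
Qed.

Lemma dom_mem X f e y : [fset p.1 | p in f] = X -> (e, y) \in f -> e \in X.
Proof. by move=> <- ef; apply/imfsetP; exists (e, y). Qed.

Lemma dom_ex X f e : [fset p.1 | p in f] = X -> e \in X -> exists y, (e, y) \in f.
Proof. by move=> <- /imfsetP[[d y] /= df ->]; exists y. Qed.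

Lemma ran_mem Y f e y : [fset p.2 | p in f] = Y -> (e, y) \in f -> y \in Y.
Proof. by move=> <- ef; apply/imfsetP; exists (e, y). Qed.

Lemma ran_ex Y f y : [fset p.2 | p in f] = Y -> y \in Y -> exists e, (e, y) \in f.
Proof. by move=> <- /imfsetP[[e w] /= ef ->]; exists e. Qed.

Lemma mem_frestr f Z e y : ((e, y) \in frestr f Z) = ((e, y) \in f) && (e \in Z).
Proof. by rewrite !inE. Qed.

Definition img f Z : {fset F} := [fset p.2 | p in frestr f Z].

Lemma imgP f Z y : reflect (exists2 e, e \in Z & (e, y) \in f) (y \in img f Z).
Proof.
apply: (iffP (imfsetP _ _ _ _)) => [[[e w]]|[e eZ ef]] /=.
  by rewrite mem_frestr => /andP[ef eZ] ->; exists e.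
by exists (e, y); rewrite // mem_frestr ef.
Qed.

Section Bijections.
Variables (X : {fset E}) (Y : {fset F}) (f : {fset E * F}).
Hypothesis bij_f : bij_graph X Y f.

Lemma bij_eq e y e' y' : (e, y) \in f -> (e', y') \in f -> (e == e') = (y == y').
Proof. by case: bij_f => _ _ b ef ef'; apply: (b _ _ ef ef'). Qed.

Lemma mem_img Z e y : (e, y) \in f -> (y \in img f Z) = (e \in Z).
Proof.
move=> ef; apply/imgP/idP=> [[d dZ df]|eZ]; last by exists e.
by rewrite (eqP (_ : e == d)) // (bij_eq ef df).
Qed.

Lemma img_sub Z : img f Z `<=` Y.
Proof. by case: bij_f => _ rY _; apply/fsubsetP=> y /imgP[e _ /(ran_mem rY)]. Qed.

Lemma img_dom : img f X = Y.
Proof.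
case: bij_f => dX rY _; apply/fsetP=> y; apply/idP/idP; first exact/fsubsetP/img_sub.
by move=> /(ran_ex rY)[e ef]; rewrite (mem_img _ ef) (dom_mem dX ef).
Qed.

Lemma img_fsetD1 Z e y : (e, y) \in f -> img f (Z `\ e) = img f Z `\ y.
Proof.
move=> ef; apply/fsetP=> w; rewrite in_fsetD1; apply/imgP/andP => [[d]|[wy /imgP[d dZ df]]].
  rewrite in_fsetD1 => /andP[de dZ] df; rewrite -(bij_eq df ef) de.
  by split=> //; apply/imgP; exists d.
by exists d; rewrite // in_fsetD1 dZ (bij_eq df ef) wy.
Qed.

End Bijections.

Hypothesis D_stable : stable D.

(** An isomorphism preserves and reflects causality, so the image of a causally closed set is
    causally closed in [Y], and [down_closed_conf] applies. *)
Lemma iso_img_conf X Y f Z : conf_iso C D X Y f -> Y \in confs D -> Z `<=` X ->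
  (forall d e, d \in X -> e \in Z -> scause C X d e -> d \in Z) ->
  img f Z \in confs D.
Proof.
move=> /conf_isoP[bf _ o] YD sZX dc; have [dX rY _] := bf.
apply: down_closed_conf YD (img_sub bf Z) _ => // v w vY /imgP[e eZ ef].
have [d df] := ran_ex rY vY.
rewrite -(o _ _ df ef) (mem_img bf _ df) /=; apply: dc => //; exact: dom_mem df.
Qed.

End Isomorphisms.

(** * The formulas [theta] express isomorphism *)

Section Theta.
Variables (Act : finType) (E F Id : choiceType).
Variables (C : conf_struct Act E) (D : conf_struct Act F).
Variables (z : E -> Id) (en : {fset E} -> seq E).
Hypothesis D_stable : stable D.
Hypothesis en_causal : causal_enumeration C en.
Implicit Types (X Z : {fset E}) (Y : {fset F}) (f : {fset E * F}).
Implicit Types (rho : env Id F) (psi : eil Act Id).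

(* What the formulas [chi n X] do not express but their evaluation preserves; *)
(* for instance [theta X] alone neither bounds [Y] nor mentions labels.       *)
Definition compat X Y rho f : Prop :=
  [/\ X \in confs C, Y \in confs D, #|` X| = #|` Y|, [fset p.1 | p in f] = X
    & {in f, forall p, rho (z p.1) = Some p.2 /\ lab C p.1 = lab D p.2}].

(** The list [m] collects the events removed along the chain of reverse modalities, in order; they
    are distinct because a removed event is no longer available. *)
Lemma sat_foldr_Rev_elim rho psi l Y : Y \in confs D ->
  sat D Y rho (foldr Rev psi (map z l)) ->
  exists m, [/\ map (rho \o z) l = map Some m, uniq m, {subset m <= Y},
    Y `\` [fset y in m] \in confs D & sat D (Y `\` [fset y in m]) rho psi].
Proof.
elim: l Y => [|d l IH] Y YD /=.
  by exists [::]; rewrite (_ : _ `\` _ = Y) //; apply/fsetP=> y; rewrite !inE.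
move=> [Y' [y [/stepP[Y'D _ yY' eY] ry _ /(IH _ Y'D)[m [em um sm mD ms]]]]].
exists (y :: m); rewrite /= ry em um andbT.
have -> : Y `\` [fset w in y :: m] = Y' `\` [fset w in m].
  apply/fsetP=> w; rewrite eY !inE negb_or; case: (eqVneq w y) => //= ->.
  by rewrite (negPf yY') andbF.
split=> //; first by apply: contra yY'; apply: sm.
by move=> w; rewrite inE eY !inE => /predU1P[->|/sm->]; rewrite ?eqxx ?orbT.
Qed.

(** The events of [l] can be removed from [Z] in order when none is removed before an event it
    causes, and when [l] contains everything in [Z] caused by its members. Then every intermediate
    set is causally closed, so its image is a configuration. The condition on [fi psi] yields
    permissibility: the identifiers of [psi] name events that survive all removals. *)
Lemma sat_foldr_Rev_intro X Y rho f psi l Z :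
  conf_iso C D X Y f -> Y \in confs D ->
  {in f, forall p, rho (z p.1) = Some p.2} ->
  Z `<=` X -> uniq l -> {subset l <= Z} ->
  (forall d e, d \in X -> e \in Z -> scause C X d e -> d \in Z) ->
  pairwise (fun b c => ~~ scause C X b c) l ->
  (forall c b, c \in l -> b \in Z -> scause C X c b -> b \in l) ->
  (forall w, w \in fi psi -> exists d, [/\ d \in Z, d \notin l & w = z d]) ->
  sat D (img f (Z `\` [fset d in l])) rho psi ->
  sat D (img f Z) rho (foldr Rev psi (map z l)).
Proof.
move=> iso YD rf; have /conf_isoP[bf _ _] := iso; have [dX _ _] := bf.
elim: l Z => [|d l IH] Z sZX /=.
  rewrite (_ : _ `\` _ = Z) //; by apply/fsetP=> y; rewrite !inE.
move=> /andP[dl ul] slZ dcZ /andP[/allP pd pl] ucl fip satp.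
have dZ : d \in Z by apply: slZ; rewrite inE eqxx.
have [y df] := dom_ex dX (fsubsetP sZX d dZ).
(* If the first event [d] caused some [c] left in [Z], then [c] would be in [l], hence removed later
   than [d], which the order of [l] forbids. *)
have dcZd b c : b \in X -> c \in Z `\ d -> scause C X b c -> b \in Z `\ d.
  rewrite !in_fsetD1 => bX /andP[cd cZ] bc; rewrite (dcZ b c) // andbT.
  apply/eqP=> bd; rewrite {}bd in bc bX.
  have := ucl d c; rewrite !inE eqxx cZ (negPf cd) => /(_ isT isT bc) /pd.
  by rewrite bc.
have sZd : Z `\ d `<=` X := fsubset_trans (fsubD1set _ _) sZX.
exists (img f (Z `\ d)), y; split.
- rewrite (img_fsetD1 bf _ df); apply: step_fsetD1; rewrite ?(mem_img bf _ df) //.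
    exact: (iso_img_conf D_stable iso).
  rewrite -(img_fsetD1 bf _ df); exact: (iso_img_conf D_stable iso).
- exact: (rf _ df).
- move=> w; rewrite fi_foldr_Rev => wfi.
  have [c [cZ -> {w wfi}]] : exists c, c \in Z `\ d /\ w = z c.
    case/orP: wfi => [/mapP[c cl ->]|/fip[c [cZ cl ->]]]; exists c; split=> //.
      rewrite in_fsetD1 slZ ?inE ?cl ?orbT // andbT.
      by apply: contraNneq dl => <-.
    by move: cl; rewrite in_fsetD1 inE negb_or cZ => /andP[->].
  have [u cf] := dom_ex dX (fsubsetP sZd c cZ).
  by exists u; [exact: (rf _ cf)|rewrite (mem_img bf _ cf)].
- apply: IH => //.
  + move=> c cl; rewrite in_fsetD1 slZ ?inE ?cl ?orbT // andbT.
    by apply: contraNneq dl => <-.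
  + move=> c b cl; rewrite in_fsetD1 => /andP[bd bZ] cb.
    by have := ucl c b; rewrite !inE cl orbT (negPf bd) => /(_ isT bZ cb).
  + move=> w /fip[c [cZ]]; rewrite inE negb_or => /andP[cd cl ->].
    by exists c; rewrite in_fsetD1 cd.
  + rewrite (_ : _ `\` _ = Z `\` [fset c in d :: l]) //.
    by apply/fsetP=> c; rewrite !inE negb_or andbCA andbA.
Qed.

Lemma fi_theta X e : X \in confs C -> e \in fi (theta C z en X) ->
  exists2 d, d \in X & e = z d.
Proof.
move=> XC; have [_ enX _] := en_causal XC.
have en_sub l : {subset l <= en X} -> e \in map z l -> exists2 d, d \in X & e = z d.
  by move=> sl /mapP[d /sl dl ->]; exists d; rewrite -?enX.
have : fi (theta C z en X) =
    fi (theta0 Act z en X) `|` fi (bigAnd [seq theta_at C z en X e | e <- en X]).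
  by rewrite /theta; case: (en X) => [|d s] //=; rewrite fsetU0.
move=> ->; rewrite inE => /orP[|/fi_bigAnd[d dX]].
  by rewrite /theta0 fi_foldr_Rev inE orbF => /en_sub; apply=> d; rewrite mem_rev.
rewrite /theta_at fi_foldr_Rev => /orP[|/fi_bigAnd[c]].
  apply: en_sub => c; rewrite mem_cat !mem_rev mem_filter.
  by case/orP=> [/mem_drop|/andP[_ /mem_take]].
rewrite mem_filter => /andP[_ cX]; rewrite /= !inE orbF => /eqP->.
by exists c; rewrite -?enX.
Qed.

Definition theta_removed X e : seq E :=
  let s := en X in let k := index e s in
  rev (drop k.+1 s) ++ rev [seq d <- take k s | ~~ scause C X d e].

(** In this form the removals, read backwards, are visibly a subsequence of the enumeration, from
    which they inherit uniqueness and causal order. *)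
Lemma theta_removed_rev X e : theta_removed X e =
  rev ([seq d <- take (index e (en X)) (en X) | ~~ scause C X d e]
        ++ drop (index e (en X)).+1 (en X)).
Proof. by rewrite rev_cat. Qed.

Lemma en_split X e : X \in confs C -> e \in X ->
  en X = take (index e (en X)) (en X) ++ e :: drop (index e (en X)).+1 (en X).
Proof.
move=> XC eX; have [_ enX _] := en_causal XC.
have es : e \in en X by rewrite enX.
by rewrite -{1}(cat_take_drop (index e (en X)) (en X)) (drop_nth e) ?index_mem // nth_index.
Qed.

Lemma theta_removed_subseq X e : X \in confs C -> e \in X ->
  subseq (rev (theta_removed X e)) (en X).
Proof.
move=> XC eX; rewrite theta_removed_rev revK [X in subseq _ X](en_split XC eX).
by rewrite cat_subseq ?filter_subseq ?subseq_cons.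
Qed.

(** All events listed after [e] are removed; the enumeration being causal, none of them lies below
    [e]. *)
Lemma mem_theta_removed X e d : X \in confs C -> e \in X -> d \in X ->
  (d \in theta_removed X e) = (d != e) && ~~ scause C X d e.
Proof.
move=> XC eX dX; have [us enX lt_en] := en_causal XC.
rewrite theta_removed_rev mem_rev mem_cat mem_filter.
have dt : scause C X d e -> d \in take (index e (en X)) (en X).
  by move=> de; rewrite in_take ?enX //; apply: lt_en.
have := en_split XC eX; set t := take _ _; set r := drop _ _ => ets.
move: us dX; rewrite -enX ets cat_uniq mem_cat inE => /and3P[_ /norP[/= et /hasPn tr]].
move=> /andP[er _] dX; have [de|/=] := boolP (scause C X d e).
  by rewrite /= andbF; apply/negP=> /tr /=; rewrite dt.
rewrite andbT => _; case: (eqVneq d e) dX => [->|_]; last by [].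
by rewrite (negPf et) (negPf er).
Qed.

Lemma down_theta_removed X e : X \in confs C -> e \in X ->
  X `\` [fset d in theta_removed X e] = down C X e.
Proof.
move=> XC eX; apply/fsetP=> d; rewrite in_fsetD.
have [dX|dX] := boolP (d \in X); last by rewrite andbF !inE (negPf dX).
rewrite andbT mem_down // in_fset mem_theta_removed //.
by rewrite negb_and !negbK.
Qed.

Lemma pairwise_en X : X \in confs C ->
  pairwise (fun c b => ~~ scause C X b c) (en X).
Proof.
move=> XC; have [us enX lt_en] := en_causal XC.
case es: (en X) => [|x0 s'] //; rewrite -es; apply/(pairwiseP x0) => i j.
rewrite !inE => si sj ij; apply/negP=> /lt_en.
by rewrite -!enX !mem_nth // !index_uniq // ltnNge ltnW // => /(_ isT isT).
Qed.

Lemma sat_theta_bij X Y rho f : compat X Y rho f ->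
  sat D Y rho (theta0 Act z en X) -> bij_graph X Y f.
Proof.
move=> [XC YD cXY dX rl]; have [us enX _] := en_causal XC.
move=> /(sat_foldr_Rev_elim YD)[m [em um sm _ _]].
(* The removed events [m] are distinct members of [Y], as many as there are in [X], so they exhaust
   [Y]. *)
have fY : [fset p.2 | p in f] = Y.
  have [] := uniq_min_size um sm; rewrite ?cXY //.
    have := congr1 size em; rewrite !size_map size_rev => <-.
    rewrite -cXY; apply: eq_leq; apply/eqP; rewrite eq_sym.
    by apply/eqP/perm_size; apply: uniq_perm.
  move=> _ mY; apply/fsetP=> y; rewrite -mY; apply/idP/idP => [/imfsetP[[d w] /= df ->]|ym].
    rewrite -(mem_map Some_inj) -em; apply/mapP; exists d.
      by rewrite mem_rev enX (dom_mem dX df).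
    by have [] := rl _ df.
  have : Some y \in map Some m by rewrite mem_map //; apply: Some_inj.
  rewrite -em => /mapP[d]; rewrite mem_rev enX => /(dom_ex dX)[w df] /=.
  by have [-> _ [->]] := rl _ df; apply/imfsetP; exists (d, w).
have inj1 : {in f &, injective (fun p : E * F => p.1)}.
  move=> [d v] [e w] df ef /= de; rewrite {}de in df *; congr pair.
  by apply: Some_inj; have [<- _] := rl _ df; have [<- _] := rl _ ef.
(* By [inj1] the graph has as many pairs as [X] has events, hence as many as its second projection
   has values; so that projection is injective too. *)
have inj2 : {in f &, injective (fun p : E * F => p.2)}.
  by apply/card_in_imfsetP; rewrite fY -cXY -dX; apply/card_in_imfsetP.
split=> // p q pf qf; apply/eqP/eqP => [/(inj1 _ _ pf qf)->|/(inj2 _ _ pf qf)->] //.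
Qed.

Lemma sat_theta_at_order X Y rho f e w : compat X Y rho f -> bij_graph X Y f ->
  (e, w) \in f -> sat D Y rho (theta_at C z en X e) ->
  {in f, forall p, scause C X p.1 e = scause D Y p.2 w}.
Proof.
move=> [XC YD _ dX rl] bf ef; have [_ rY _] := bf; have eX := dom_mem dX ef.
have [_ enX _] := en_causal XC.
move=> /(sat_foldr_Rev_elim YD)[m [em _ _]].
(* The removals leave exactly the partners of the events below or equal to [e]. *)
have -> : Y `\` [fset y in m] = img f (down C X e).
  rewrite -down_theta_removed //; apply/fsetP=> y; rewrite in_fsetD.
  have [yY|yY] := boolP (y \in Y); last first.
    rewrite andbF; apply/esym; apply: contraNF yY; exact: (fsubsetP (img_sub bf _)).
  have [d df] := ran_ex rY yY.
  rewrite (mem_img bf _ df) in_fsetD (dom_mem dX df) !andbT !in_fset; congr (~~ _).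
  rewrite -(mem_map Some_inj) -em; apply/mapP/idP => [[c]|dr]; last first.
    by exists d => //=; have [->] := rl _ df.
  move=> cr; have cX : c \in X.
    by rewrite -enX; apply: (mem_subseq (theta_removed_subseq XC eX)); rewrite mem_rev.
  have [u cf] := dom_ex dX cX; have [/= -> _ [yu]] := rl _ cf.
  by rewrite (eqP (_ : d == c)) // (bij_eq bf df cf) yu.
set W := img f _ => WD.
move=> /sat_bigAnd satW [d v] df /=.
have sWY : W `<=` Y := img_sub bf _.
have wW : w \in W by rewrite (mem_img bf _ ef) mem_down ?eqxx.
have vW : (v \in W) = (d == e) || scause C X d e.
  by rewrite (mem_img bf _ df) mem_down // (dom_mem dX df).
(* If [v] is below [w], the configuration [W] contains it along with [w], and membership in [W]
   means lying below or at [e] in [X]. *)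
apply/idP/idP => [de|dw]; last first.
  have := conf_down_closed WD sWY wW dw; rewrite vW => /predU1P[ed|//].
  by move: dw; rewrite /scause -(bij_eq bf df ef) ed eqxx andbF.
rewrite /scause -(bij_eq bf df ef); have /andP[_ ->] := de; rewrite andbT.
rewrite de orbT in vW; apply: contrapT => /negP ndw.
(* Otherwise [v] witnesses that [down D W w] is a proper part of [W], so some [c] other than [w] is
   removable from [W]. Its partner [b] is strictly below [e], and the negative conjunct for [b] is
   violated. *)
have [|c] := removable_outside D_stable (down_conf D_stable WD wW) WD.
  rewrite fproperE; apply/andP; split.
    by apply/fsubsetP=> y; rewrite in_down => /andP[].
  apply/negP=> /fsubsetP/(_ _ vW); rewrite in_down (cause_sub D_stable v YD) //.
  by rewrite (negPf ndw) andbF.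
rewrite in_fsetD => /andP[cV cW] WcD.
have [b bd bf'] := imgP _ _ _ cW.
have bX := dom_mem dX bf'.
have be : b != e.
  by rewrite (bij_eq bf bf' ef); apply: contraNneq cV => ->; rewrite mem_down ?eqxx.
move: bd; rewrite mem_down // (negPf be) /= => bde.
have /satW[] : b \in [seq d <- en X | scause C X d e] by rewrite mem_filter bde enX.
exists (W `\ c), c; split=> //; first exact: step_fsetD1.
by have [] := rl _ bf'.
Qed.

Lemma sat_theta X Y rho f : compat X Y rho f ->
  sat D Y rho (theta C z en X) <-> conf_iso C D X Y f.
Proof.
move=> cf; have [XC YD cXY dX rl] := cf; have [us enX _] := en_causal XC.
rewrite /theta sat_bigAnd_cons sat_bigAnd; split=> [[sat0 satk]|iso].
  have bf := sat_theta_bij cf sat0; apply/conf_isoP; split=> // [p /rl[]//|].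
  move=> p [e w] pf ef; apply: (sat_theta_at_order cf bf ef) => //.
  by apply: satk; rewrite enX (dom_mem dX ef).
have rf : {in f, forall p, rho (z p.1) = Some p.2} by move=> p /rl[].
have /conf_isoP[bf _ ord] := iso; have [_ rY _] := bf.
have pw := pairwise_en XC.
split=> [|e].
  rewrite -(img_dom bf).
  apply: (sat_foldr_Rev_intro iso YD rf) => //.
  - by rewrite rev_uniq.
  - by move=> d; rewrite mem_rev enX.
  - by rewrite pairwise_rev.
  - by move=> c b _ bX _; rewrite mem_rev enX.
rewrite enX -(img_dom bf) => eX.
have sub_r := theta_removed_subseq XC eX.
have rX d : d \in theta_removed X e -> d \in X.
  by rewrite -mem_rev -enX; apply: mem_subseq.
have dmem d : d \in [seq d <- en X | scause C X d e] ->
    [/\ d \in X, scause C X d e & d \in down C X e].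
  by rewrite mem_filter enX => /andP[de dX']; rewrite mem_down // de orbT.
have [w ef] := dom_ex dX eX.
rewrite /theta_at -/(theta_removed X e).
apply: (sat_foldr_Rev_intro iso YD rf) => //.
- by rewrite -rev_uniq; apply: subseq_uniq us.
- by rewrite -[theta_removed _ _]revK pairwise_rev; apply: subseq_pairwise pw.
(* What is not below or equal to [e] cannot cause anything that is. *)
- move=> c b cr bX cb; rewrite mem_theta_removed //; move: (cr).
  rewrite (mem_theta_removed XC eX (rX _ cr)) => /andP[ce]; rewrite /scause ce andbT => nce.
  move: cb => /andP[/causeP cb _]; apply/andP; split.
    by apply: contraNneq nce => be; rewrite -be; apply/causeP.
  rewrite negb_and; apply/orP; left; apply: contra nce => /causeP be.
  by apply/causeP=> V VC sV eV; apply: cb => //; apply: be.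
- move=> u /fi_bigAnd[d /dmem[dX' de _]]; rewrite /= !inE orbF => /eqP->.
  by exists d; split=> //; rewrite mem_theta_removed // de andbF.
(* If the partner [v] of some [d] strictly below [e] were removable, the remaining configuration
   would still contain [w], hence also its cause [v]. *)
rewrite down_theta_removed //; apply/sat_bigAnd => d /dmem[dX' de dd] /=.
move=> [V [v [/stepP[VD _ vV eW] rd _ _]]].
have [v' df] := dom_ex dX dX'; move: rd; rewrite (rf _ df) => -[v'v]; subst v'.
have sVY : V `<=` Y.
  by apply: fsubset_trans (img_sub bf (down C X e)); rewrite eW fsubsetU1.
have wV : w \in V.
  have : w \in v |` V by rewrite -eW (mem_img bf _ ef) mem_down ?eqxx.
  rewrite in_fset1U => /predU1P[wv|//]; move: de; rewrite /scause (bij_eq bf df ef) wv eqxx.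
  by rewrite andbF.
move: vV; rewrite (conf_down_closed VD sVY wV) //.
by rewrite -(ord _ _ df ef).
Qed.

End Theta.

(** * Approximants of HH bisimilarity and their stabilisation *)

Section Approximants.
Variables (Act : finType) (E F : choiceType).
Variables (C : conf_struct Act E) (D : conf_struct Act F).
Implicit Types (X : {fset E}) (Y : {fset F}) (f : {fset E * F}).

(* No clause for the backward steps of [Y]: an isomorphism transports them.   *)
Fixpoint approx n X Y f : Prop :=
  [/\ X \in confs C, Y \in confs D, conf_iso C D X Y f &
    if n is m.+1 then
      [/\ forall e X', step C X e X' ->
            exists w Y', step D Y w Y' /\ approx m X' Y' ((e, w) |` f),
          forall w Y', step D Y w Y' ->
            exists e X', step C X e X' /\ approx m X' Y' ((e, w) |` f)
        & forall e X', step C X' e X ->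
            exists w Y', [/\ step D Y' w Y, (e, w) \in f & approx m X' Y' (frestr f X')]]
    else True].

Lemma approx_iso n X Y f : approx n X Y f ->
  [/\ X \in confs C, Y \in confs D & conf_iso C D X Y f].
Proof. by case: n => [|n] []. Qed.

(** Serves twice: it makes the chain decreasing, and it propagates an equality between consecutive
    approximants. *)
Lemma approx_succ_mono m n : (forall X Y f, approx m X Y f -> approx n X Y f) ->
  forall X Y f, approx m.+1 X Y f -> approx n.+1 X Y f.
Proof.
move=> mn X Y f [XC YD iso [h1 h2 h3]]; split=> //; split.
- by move=> e X' /h1[w [Y' [st /mn ap]]]; exists w, Y'.
- by move=> w Y' /h2[e [X' [st /mn ap]]]; exists e, X'.
- by move=> e X' /h3[w [Y' [st ef /mn ap]]]; exists w, Y'.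
Qed.

Lemma approxS n X Y f : approx n.+1 X Y f -> approx n X Y f.
Proof.
elim: n X Y f => [|n IH] X Y f; first by case.
exact: approx_succ_mono.
Qed.

(** The set whose cardinality is [num_isos]. *)
Definition isos : {fset {fset E} * {fset F} * {fset E * F}} :=
  [fset t in (confs C `*` confs D) `*` fpowerset (events C `*` events D)
    | conf_iso C D t.1.1 t.1.2 t.2].

Definition approx_set n := [fset t in isos | `[< approx n t.1.1 t.1.2 t.2 >]].

Lemma mem_approx_set n X Y f : (X, Y, f) \in approx_set n <-> approx n X Y f.
Proof.
rewrite in_fset inE /=; split=> [/andP[_ /asboolP]//|ap].
apply/andP; split; last exact/asboolP.
have [XC YD iso] := approx_iso ap; have /conf_isoP[[dX rY _] _ _] := iso.
rewrite in_fset inE /= !inE /= XC YD iso andbT /= fpowersetE.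
apply/fsubsetP=> -[e w] ef; rewrite inE /=.
rewrite (fsubsetP (sub_events XC) _ (dom_mem dX ef)).
by rewrite (fsubsetP (sub_events YD) _ (ran_mem rY ef)).
Qed.

Lemma approx_setS n : approx_set n.+1 `<=` approx_set n.
Proof.
by apply/fsubsetP=> -[[X Y] f] /mem_approx_set/approxS ap; apply/mem_approx_set.
Qed.

Lemma approx_stable n : #|` isos| <= n ->
  forall X Y f, approx n X Y f -> approx n.+1 X Y f.
Proof.
(* Until the chain is stationary, each step loses an isomorphism. In the second alternative, [n]
   being at least the number of isomorphisms forces the approximant to be empty, and the claim holds
   vacuously. *)
suff: (forall X Y f, approx n X Y f -> approx n.+1 X Y f) \/
    #|` approx_set n| + n <= #|` isos|.
  case=> [//|le_n n_le X Y f /mem_approx_set ap].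
  have := leq_trans le_n n_le; rewrite -[X in _ <= X]add0n leq_add2r leqn0 cardfs_eq0.
  by move=> /eqP e0; rewrite e0 inE in ap.
elim: n => [|n [IH|IH]].
- by right; rewrite addn0 fsubset_leq_card // fset_sub.
- by left; apply: approx_succ_mono.
have [eq_n|ne_n] := eqVneq (approx_set n.+1) (approx_set n).
  left; apply: approx_succ_mono => X Y f /mem_approx_set.
  by rewrite -eq_n => /mem_approx_set.
right; rewrite addnS; apply: leq_trans IH; rewrite -addSn leq_add2r.
by apply: fproper_ltn_card; rewrite fproperEneq ne_n approx_setS.
Qed.

End Approximants.

(** * Approximants versus bisimulations *)

Section ApproximantsBisimulation.
Variables (Act : finType) (E F : choiceType).
Variables (C : conf_struct Act E) (D : conf_struct Act F).
Implicit Types (X : {fset E}) (Y : {fset F}) (f : {fset E * F}).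

Lemma frestr_setU1 X f e w : [fset p.1 | p in f] = X -> e \notin X ->
  frestr ((e, w) |` f) X = f.
Proof.
move=> dX eX; apply/fsetP=> -[d u]; rewrite mem_frestr in_fset1U xpair_eqE.
case: (eqVneq d e) => [->|_] /=.
  rewrite (negPf eX) andbF; apply/esym/negP=> /(dom_mem dX).
  by apply/negP.
by apply: andb_idr => /(dom_mem dX).
Qed.

(** Links the arbitrary [f'] of a bisimulation to the explicit extension in [approx]: the partner of
    [e] cannot be in [Y], where every event already has a partner in [X]. *)
Lemma bij_graph_extension X X' Y Y' f f' e w :
  bij_graph X Y f -> bij_graph X' Y' f' -> step C X e X' -> step D Y w Y' ->
  frestr f' X = f -> f' = (e, w) |` f.
Proof.
move=> [dX rY _] bf' /stepP[_ _ eX eX'] /stepP[_ _ wY eY'] ff; have [dX' rY' _] := bf'.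
have ew : (e, w) \in f'.
  have [|u eu] := @dom_ex _ _ _ _ e dX'; first by rewrite eX' !inE eqxx.
  have := ran_mem rY' eu; rewrite eY' in_fset1U => /predU1P[<-//|/(ran_ex rY)[d]].
  rewrite -ff mem_frestr => /andP[du dX0].
  by case/negP: eX; rewrite (eqP (_ : e == d)) // (bij_eq bf' eu du).
apply/fsetP=> -[d u]; rewrite in_fset1U -ff mem_frestr xpair_eqE.
have [du|du] /= := boolP ((d, u) \in f').
  have := dom_mem dX' du; rewrite eX' in_fset1U => /orP[de|->]; last by rewrite orbT.
  by rewrite de -(bij_eq bf' du ew) de.
by rewrite orbF; apply/esym/negP=> /andP[/eqP de /eqP uw]; rewrite de uw ew in du.
Qed.

Lemma bij_graph_restriction X X' Y Y' f e w :
  bij_graph X Y f -> bij_graph X' Y' (frestr f X') -> step C X' e X -> step D Y' w Y ->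
  (e, w) \in f.
Proof.
move=> bf [_ rY' _] /stepP[_ _ eX' eX] /stepP[_ _ _ eY]; have [dX rY _] := bf.
have [|u eu] := @dom_ex _ _ _ _ e dX; first by rewrite eX !inE eqxx.
have := ran_mem rY eu; rewrite eY in_fset1U => /predU1P[<-//|/(ran_ex rY')[d]].
rewrite mem_frestr => /andP[du dX'].
by case/negP: eX'; rewrite (eqP (_ : e == d)) // (bij_eq bf eu du).
Qed.

Lemma hh_bisimulation_approx R n X Y f :
  hh_bisimulation C D R -> R X Y f -> approx C D n X Y f.
Proof.
move=> [_ bisR]; elim: n X Y f => [|n IH] X Y f RXY;
  have [[XC YD iso] moves] := bisR _ _ _ RXY; split=> //.
have /conf_isoP[bf _ _] := iso; split.
- move=> e X' st; have [fwC _ _ _] := moves (lab C e).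
  have [|Y' [f' [[w st' _] RXY' ff]]] := fwC X'; first by exists e.
  exists w, Y'; split=> //; have [[_ _ /conf_isoP[bf' _ _]] _] := bisR _ _ _ RXY'.
  by rewrite -(bij_graph_extension bf bf' st st' ff); apply: IH.
- move=> w Y' st'; have [_ fwD _ _] := moves (lab D w).
  have [|X' [f' [[e st _] RXY' ff]]] := fwD Y'; first by exists w.
  exists e, X'; split=> //; have [[_ _ /conf_isoP[bf' _ _]] _] := bisR _ _ _ RXY'.
  by rewrite -(bij_graph_extension bf bf' st st' ff); apply: IH.
- move=> e X' st; have [_ _ bwC _] := moves (lab C e).
  have [|Y' [f' [[w st' _] RXY' ff]]] := bwC X'; first by exists e.
  rewrite -{}ff in RXY'; exists w, Y'; split=> //; last exact: IH.
  have [[_ _ /conf_isoP[bf' _ _]] _] := bisR _ _ _ RXY'.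
  exact: bij_graph_restriction bf bf' st st'.
Qed.

Hypothesis C_stable : stable C.

(** A removable [w] is maximal in [Y], so its partner [e] is maximal in [X], and [X] without [e] is
    causally closed. *)
Lemma step_pred_iso X Y Y' f w : X \in confs C -> conf_iso C D X Y f ->
  step D Y' w Y -> exists2 e, (e, w) \in f & step C (X `\ e) e X.
Proof.
move=> XC /conf_isoP[bf _ ord] /stepP[Y'D _ wY' eY]; have [dX rY _] := bf.
have [|e ew] := @ran_ex _ _ _ _ w rY; first by rewrite eY !inE eqxx.
exists e => //; apply: step_fsetD1 => //; last exact: dom_mem ew.
apply: (down_closed_conf C_stable XC (fsubD1set _ _)) => d c dX0.
rewrite !in_fsetD1 dX0 andbT => /andP[ce cX] dc; apply/eqP=> de; rewrite {}de in dc.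
have [u cu] := dom_ex dX cX; rewrite (ord _ _ ew cu) in dc.
case/negP: wY'; apply: (conf_down_closed Y'D _ _ dc).
  by rewrite eY fsubsetU1.
have := ran_mem rY cu; rewrite eY in_fset1U => /predU1P[/eqP|//].
by rewrite -(bij_eq bf cu ew) (negPf ce).
Qed.

Lemma approx_hh_bisimulation n :
  (forall X Y f, approx C D n X Y f -> approx C D n.+1 X Y f) ->
  approx C D n fset0 fset0 fset0 -> hh_bisimulation C D (approx C D n).
Proof.
move=> apS ap0; split=> // X Y f /apS[XC YD iso [fwC fwD bwC]]; split=> // a.
have /conf_isoP[bf lf _] := iso; have [dX _ _] := bf.
have lab_ext X' Y' e w : approx C D n X' Y' ((e, w) |` f) -> lab C e = lab D w.
  by case/approx_iso=> _ _ /conf_isoP[_ l _]; apply: (l (e, w)); rewrite !inE eqxx.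
split.
- move=> X' [e st <-]; have [w [Y' [st' ap]]] := fwC e X' st.
  exists Y', ((e, w) |` f); split=> //; first by exists w; rewrite // (lab_ext _ _ _ _ ap).
  by apply: frestr_setU1 => //; case/stepP: st.
- move=> Y' [w st' <-]; have [e [X' [st ap]]] := fwD w Y' st'.
  exists X', ((e, w) |` f); split=> //; first by exists e; rewrite // (lab_ext _ _ _ _ ap).
  by apply: frestr_setU1 => //; case/stepP: st.
- move=> X' [e st <-]; have [w [Y' [st' ew ap]]] := bwC e X' st.
  by exists Y', (frestr f X'); split=> //; exists w; rewrite // -(lf _ ew).
- move=> Y' [w st' <-]; have [e ew st] := step_pred_iso XC iso st'.
  (* The answer to the removal of [e] must remove its partner [w], so it is the given step of
     [D]. *)
  have [u [Y'' [st'' eu ap]]] := bwC e _ st.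
  have uw : u = w by apply/eqP; rewrite -(bij_eq bf eu ew).
  have [_ eY'] := step_pred st'; have [_ eY''] := step_pred st''.
  rewrite eY'' uw -eY' in ap.
  by exists (X `\ e), (frestr f (X `\ e)); split=> //; exists e; rewrite // (lf _ ew).
Qed.

End ApproximantsBisimulation.

(** * Characteristic formulas express the approximants *)

Section CharacteristicFormulas.
Variables (Act : finType) (E F Id : choiceType).
Variables (C : conf_struct Act E) (D : conf_struct Act F).
Hypothesis D_stable : stable D.
Hypothesis Id_inf : forall A : {fset Id}, exists y, y \notin A.
Variable z : E -> Id.
Hypothesis z_inj : {in events C &, injective z}.
Variable x : Id.
Hypothesis x_new : forall e, e \in events C -> x != z e.
Variable en : {fset E} -> seq E.
Hypothesis en_causal : causal_enumeration C en.
Implicit Types (X : {fset E}) (Y : {fset F}) (f : {fset E * F}) (rho : env Id F).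

Let chi := chi Id_inf C z x en.

Lemma mem_fwd X p : (p \in fwd C X) = step C X p.1 p.2.
Proof.
rewrite in_fset inE /= inE; apply: andb_idl => st; have [eX' _] := step_pred st.
case/stepP: st => _ X'C _ _; rewrite X'C andbT.
exact: (fsubsetP (sub_events X'C)).
Qed.

Lemma mem_bwd X p : (p \in bwd C X) = step C p.2 p.1 X.
Proof.
rewrite in_fset inE /= inE; apply: andb_idl => st; have [eX _] := step_pred st.
case/stepP: st => X'C XC _ _; rewrite X'C andbT.
exact: (fsubsetP (sub_events XC)).
Qed.

(** Used for permissibility under [Rev] and to see which identifiers the substitution of [x] leaves
    alone. *)
Lemma fi_chi n X v : X \in confs C -> v \in fi (chi n X) ->
  exists2 d, d \in X & v = z d.
Proof.
elim: n X v => [|n IH] X v XC; first exact: fi_theta.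
rewrite /= !in_fsetU -!orbA => /or4P[].
- exact: fi_theta.
- case/fi_bigAnd=> -[e X'] /=; rewrite mem_fwd in_fsetD1 /= => /stepP[_ X'C _ eX'].
  case/andP=> ve /(IH _ _ X'C)[d dX' vd]; exists d => //.
  by move: dX'; rewrite eX' in_fset1U => /predU1P[de|//]; rewrite vd de eqxx in ve.
- case/fi_bigAnd=> a _; rewrite /= in_fsetD1 => /andP[vx /fi_bigOr[[e X']]].
  rewrite mem_filter mem_fwd => /andP[_ /stepP[_ X'C _ eX']].
  rewrite fi_rename => /imfsetP[u /= /(IH _ _ X'C)[d dX' ->]].
  case: (eqVneq (z d) (z e)) => [_ vx'|zde ->]; first by rewrite vx' eqxx in vx.
  exists d => //; move: dX'; rewrite eX' in_fset1U => /predU1P[de|//].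
  by rewrite de eqxx in zde.
- case/fi_bigAnd=> -[e X']; rewrite mem_bwd => /stepP[X'C _ _ eX].
  rewrite /= in_fset1U => /predU1P[->|/(IH _ _ X'C)[d dX' ->]].
    by exists e; rewrite // eX !inE eqxx.
  by exists d; rewrite // eX !inE dX' orbT.
Qed.

(** Injectivity of [z] on events keeps the update at [z e] from overwriting the values that encode
    [f]. *)
Lemma compat_extend X X' Y Y' rho f e w : compat C D z X Y rho f ->
  step C X e X' -> step D Y w Y' -> lab C e = lab D w ->
  compat C D z X' Y' (upd rho (z e) w) ((e, w) |` f).
Proof.
move=> [_ _ cXY dX rl] /stepP[_ X'C eX eX'] /stepP[_ Y'D wY eY'] lew.
split=> //; first by rewrite eX' eY' !cardfsU1 eX wY cXY.
  apply/fsetP=> d; rewrite eX' in_fset1U; apply/imfsetP/orP => [[[b u]] /=|].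
    rewrite in_fset1U xpair_eqE => /orP[/andP[be _] ->|bu ->]; first by left.
    by right; apply: dom_mem dX bu.
  case=> [/eqP->|/(dom_ex dX)[u du]]; first by exists (e, w); rewrite // !inE eqxx.
  by exists (d, u); rewrite // in_fset1U du orbT.
move=> [d u]; rewrite in_fset1U => /predU1P[[-> ->]|du]; first by rewrite /upd /= eqxx.
have dX0 := dom_mem dX du; have sX' := fsubsetP (sub_events X'C).
rewrite /upd /= ifN; first exact: (rl _ du).
apply/eqP=> /(z_inj (sX' _ _) (sX' _ _)); rewrite eX' !in_fset1U dX0 eqxx orbT.
by move=> /(_ isT isT) de; rewrite -de dX0 in eX.
Qed.

Lemma compat_frestr X X' Y Y' rho f e w : compat C D z X Y rho f ->
  step C X' e X -> step D Y' w Y -> compat C D z X' Y' rho (frestr f X').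
Proof.
move=> [_ _ cXY dX rl] /stepP[X'C _ eX eX'] /stepP[Y'D _ wY eY'].
split=> //.
- by move: cXY; rewrite eX' eY' !cardfsU1 eX wY => -[].
- apply/fsetP=> d; apply/imfsetP/idP => [[[b u]] /=|dX'].
    by rewrite mem_frestr => /andP[_ bX] ->.
  have [|u du] := @dom_ex _ _ _ _ d dX; first by rewrite eX' !inE dX' orbT.
  by exists (d, u); rewrite // mem_frestr du.
- by move=> [d u]; rewrite mem_frestr => /andP[/rl].
Qed.

(** Since [x] differs from every [z d], updating it leaves the value of each identifier other than
    [z e] unchanged. *)
Lemma sat_subst_chi n Y rho e w X' : X' \in confs C -> e \in X' ->
  sat D Y (upd rho x w) (subst Id_inf x (z e) (chi n X')) <->
  sat D Y (upd rho (z e) w) (chi n X').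
Proof.
move=> X'C eX'; rewrite sat_rename; apply: sat_ext => v /(fi_chi X'C)[d dX' ->].
rewrite /upd /=; case: (eqVneq (z d) (z e)) => [_|_]; first by rewrite eqxx.
by rewrite eq_sym (negPf (x_new _)) //; apply: (fsubsetP (sub_events X'C)).
Qed.

Lemma sat_chi n X Y rho f : compat C D z X Y rho f ->
  sat D Y rho (chi n X) <-> approx C D n X Y f.
Proof.
elim: n X Y rho f => [|n IH] X Y rho f cf; have [XC YD _ dX rl] := cf.
  have /= -> := sat_theta D_stable en_causal cf.
  by split=> [|[]].
have lab_ext X' Y' e w : approx C D n X' Y' ((e, w) |` f) -> lab C e = lab D w.
  by case/approx_iso=> _ _ /conf_isoP[_ l _]; apply: (l (e, w)); rewrite !inE eqxx.
change (sat D Y rho (chi n.+1 X)) with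
  (((sat D Y rho (theta C z en X) /\
     sat D Y rho (bigAnd [seq Dia (z p.1) (lab C p.1) (chi n p.2) | p <- fwd C X])) /\
    sat D Y rho (bigAnd [seq Box x a
                   (bigOr [seq subst Id_inf x (z p.1) (chi n p.2)
                          | p <- fwd C X & lab C p.1 == a]) | a <- enum Act])) /\
   sat D Y rho (bigAnd [seq Rev (z p.1) (chi n p.2) | p <- bwd C X])).
rewrite (sat_theta D_stable en_causal cf) !sat_bigAnd.
split=> [[[[iso dia] box] rev]|[_ _ iso [fwC fwD bwC]]].
  split=> //; split.
  - move=> e X' st.
    have [|Y' [w [st' lw sw]]] := dia (e, X'); first by rewrite mem_fwd.
    by exists w, Y'; split=> //; apply/(IH _ _ _ _ (compat_extend cf st st' (esym lw))).
  (* The box for the label of [w] answers the forward step of [D]. *)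
  - move=> w Y' st'; have := box (lab D w); rewrite mem_enum => /(_ isT)/sat_Box.
    move=> /(_ Y' w st' erefl)/sat_bigOr[[e X']]; rewrite mem_filter mem_fwd /=.
    move=> /andP[/eqP lew st]; have [eX' _] := step_pred st.
    have /stepP[_ X'C _ _] := st; rewrite sat_subst_chi // => sw.
    by exists e, X'; split=> //; apply/(IH _ _ _ _ (compat_extend cf st st' lew)).
  - move=> e X' st.
    have [|Y' [w [st' rw _ sw]]] := rev (e, X'); first by rewrite mem_bwd.
    exists w, Y'; split=> //; last by apply/(IH _ _ _ _ (compat_frestr cf st st')).
    have [eX _] := step_pred st; have [u eu] := dom_ex dX eX.
    by have [] := rl _ eu; rewrite /= rw => -[->].
split; first split; first split=> //.
- move=> [e X']; rewrite mem_fwd => st; have [w [Y' [st' ap]]] := fwC _ _ st.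
  exists Y', w; split=> //; first by rewrite -(lab_ext _ _ _ _ ap).
  by apply/(IH _ _ _ _ (compat_extend cf st st' (lab_ext _ _ _ _ ap))).
- move=> a _; apply/sat_Box => Y' w st' la; have [e [X' [st ap]]] := fwD _ _ st'.
  have lew := lab_ext _ _ _ _ ap; have [eX' _] := step_pred st.
  have /stepP[_ X'C _ _] := st.
  apply/sat_bigOr; exists (e, X'); first by rewrite mem_filter mem_fwd /= lew la eqxx.
  by rewrite sat_subst_chi //; apply/(IH _ _ _ _ (compat_extend cf st st' lew)).
- move=> [e X']; rewrite mem_bwd => st; have [w [Y' [st' ew ap]]] := bwC _ _ st.
  have [X'C _ /conf_isoP[[dX' rY' _] _ _]] := approx_iso ap.
  exists Y', w; split=> //; first by have [] := rl _ ew.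
    move=> v /(fi_chi X'C)[d /(dom_ex dX')[u du] ->].
    exists u; last exact: ran_mem du.
    by move: du; rewrite mem_frestr => /andP[/rl[]].
  by apply/(IH _ _ _ _ (compat_frestr cf st st')).
Qed.

End CharacteristicFormulas.

Theorem theorem6 (Act : finType) (E F : choiceType)
    (C : conf_struct Act E) (D : conf_struct Act F)
    (C_stable : stable C) (D_stable : stable D)
    (Id : choiceType) (Id_inf : forall A : {fset Id}, exists y, y \notin A)
    (z : E -> Id) (z_inj : {in events C &, injective z})
    (x : Id) (x_new : forall e, e \in events C -> x != z e)
    (en : {fset E} -> seq E) (en_causal : causal_enumeration C en) :
  hh_bisimilar C D <->
  models D (chi_hh Id_inf C z x en (num_isos C D)).
Proof.
have cf0 : compat C D z fset0 fset0 (fun=> None) fset0.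
  split; rewrite ?fset0_conf ?cardfs0 //.
  by apply/fsetP=> e; rewrite inE; apply/imfsetP=> -[].
(* The empty environment encodes the empty isomorphism, so satisfaction becomes membership in the
   approximant. *)
rewrite /models /chi_hh (sat_chi D_stable Id_inf z_inj x_new en_causal _ cf0).
split=> [[R bisR]|ap]; first by apply: hh_bisimulation_approx bisR.1.
by exists (approx C D (num_isos C D)); apply: approx_hh_bisimulation (approx_stable _) _.
Qed.
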